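(* For every integer $k\ge 1$, $$Q_2e_k=-\binom{n-k+1}{3}e_{k-2}.$$
   Context: Let $n\ge 2$ and let $e_k=e_k(x_2,x_3,\dots,x_n)$ be the elementary symmetric polynomial of degree $k$ in the $n-1$ variables $x_2,\dots,x_n$ ($e_0=1$, and $e_k=0$ for $k<0$ or $k>n-1$). With $\partial_j=\partial/\partial x_j$, the operator $Q_2$ is $$Q_2=\sum_{j=2}^n\ \sum_{\substack{2\le i<r\le n\\ i,r\ne j}}\frac{1}{(x_j-x_i)(x_j-x_r)}\,x_j\partial_j.$$ The binomial coefficient $\binom{a}{b}$ is $0$ when $a<b$. *)

(* Defs.v *)
From HB Require Import structures.
From mathcomp Require Import all_boot all_order all_algebra.
From mathcomp Require Import fraction.
From mathcomp.multinomials Require Import mpoly.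

Set Implicit Arguments.
Unset Strict Implicit.
Unset Printing Implicit Defensive.

Import GRing.Theory.
Local Open Scope ring_scope.

(* There are m = n - 1 variables; the paper's x_2, ..., x_n are 'X_0, ...,
   'X_(m - 1).  Differences of variables are inverted in the field of rational
   functions in x_2, ..., x_n, so Q2 maps polynomials to rational functions. *)

Definition ratfun (K : fieldType) (m : nat) := {fraction {mpoly K[m]}}.

Definition esymz (K : fieldType) (m : nat) (k : int) : {mpoly K[m]} :=
  if k is Posz l then mesym m K l else 0.

Definition binz (a : int) (b : nat) : nat :=
  if a is Posz l then 'C(l, b) else 0%N.

Definition xvar (K : fieldType) (m : nat) (i : 'I_m) : ratfun K m :=
  tofrac ('X_i : {mpoly K[m]}).

Definition Q2 (K : fieldType) (m : nat) (p : {mpoly K[m]}) : ratfun K m :=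
  \sum_(j < m) \sum_(i < m | i != j) \sum_(r < m | (i < r)%N && (r != j))
     1 / ((xvar K j - xvar K i) * (xvar K j - xvar K r))
       * (xvar K j * tofrac (mderiv j p)).

(* Main.v *)
Require Import Defs.
From HB Require Import structures.
From mathcomp Require Import all_boot all_order all_algebra.
From mathcomp Require Import fraction ring zify.
From mathcomp.multinomials Require Import mpoly.

Set Implicit Arguments.
Unset Strict Implicit.
Unset Printing Implicit Defensive.

Import GRing.Theory.
Local Open Scope ring_scope.

(** Write e_k(S) for the elementary symmetric polynomial in the variables
    indexed by S.  Each e_k is affine in x_j with slope e_(k-1) in the other
    variables, so x_j d_j e_k = x_j e_(k-1)(S \ j), S being the set of all m
    indices.  The sum Q2 e_k runs over an index j and an unordered pair {i, r}
    of other indices, that is, over three-element sets {a, b, c} with a marked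
    element ([sum_by_triples]).

    Fix {a, b, c} and let U be its complement.  The contribution
    of the triple is the sum, over the three choices of the marked element a
    and with b, c the other two, of
      x_a (e_(k-1)(U) + (x_b + x_c) e_(k-2)(U) + x_b x_c e_(k-3)(U))
        / ((x_a - x_b) (x_a - x_c)),
    which is a second divided difference: the coefficients of e_(k-1)(U),
    e_(k-2)(U) and e_(k-3)(U) are the divided differences at x_a, x_b, x_c of
    a polynomial of degree one, of a quadratic with leading coefficient -1,
    and of a constant.  They are 0, -1 and 0, so the triple contributes
    - e_(k-2)(U) ([triple_contribution]).

    It remains to sum e_(k-2)(U) over all triples.  A squarefree monomial of
    degree k - 2 occurs once for each triple avoiding its k - 2 variables,
    hence 'C(m - k + 2, 3) times ([sum_esym_on_triples]); here m = n - 1.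
    No division by integers takes place, so the argument holds in every
    characteristic. *)

(** * Elementary symmetric functions of subfamilies *)

Definition esym_on (R : comNzRingType) (T : finType) (x : T -> R)
    (S : {set T}) (k : nat) : R :=
  \sum_(h : {set T} | (h \subset S) && (#|h| == k)) \prod_(i in h) x i.

Section ElementarySymmetric.

Variables (R : comNzRingType) (T : finType) (x : T -> R).

Lemma esym_on0 (S : {set T}) : esym_on x S 0 = 1.
Proof.
rewrite /esym_on (big_pred1 set0) ?big_set0 // => h.
by rewrite cards_eq0 /=; case: eqP => [->|_]; rewrite ?sub0set ?andbF.
Qed.

Lemma esym_on_gt (S : {set T}) (k : nat) :
  (#|S| < k)%N -> esym_on x S k = 0.
Proof.
move=> ltSk; rewrite /esym_on big_pred0 // => h.
apply/negP => /andP[hS /eqP hk].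
by have := subset_leq_card hS; rewrite hk leqNgt ltSk.
Qed.

(** Subsets of [a |: S] split according to whether they contain [a]; this is
    the relation that makes e_k affine in each variable. *)
Lemma esym_onU1 (S : {set T}) (a : T) (k : nat) : a \notin S ->
  esym_on x (a |: S) k.+1 = esym_on x S k.+1 + x a * esym_on x S k.
Proof.
move=> aS; rewrite /esym_on (bigID (fun h : {set T} => a \in h)) /= addrC.
congr (_ + _).
  apply: eq_bigl => h; rewrite andbAC; congr (_ && _).
  by rewrite -subsetD1 setU1K.
rewrite (reindex_onto (fun h => a |: h) (fun h => h :\ a)) /=; last first.
  by move=> h /andP[_ ah]; rewrite setD1K.
rewrite big_distrr /=.
have inS (h : {set T}) : h \subset S -> a \notin h.
  by move=> hS; apply: contra aS; apply: (subsetP hS).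
apply: eq_big => [h | h hP].
  rewrite setU11 andbT; have [ah | ah] := boolP (a \in h).
    have -> : (a |: h) :\ a == h = false.
      by apply/eqP => eh; move: ah; rewrite -eh setD11.
    rewrite andbF; case hS: (h \subset S) => //.
    by have := inS _ hS; rewrite ah.
  by rewrite setU1K // eqxx andbT cardsU1 ah eqSS subUset sub1set setU11 /=
             -[in RHS](setU1K aS) subsetD1 ah andbT.
have ah : a \notin h.
  by case/andP: hP => _ /eqP <-; rewrite setD11.
by rewrite big_setU1.
Qed.

End ElementarySymmetric.

Lemma rmorph_esym_on (R R' : comNzRingType) (f : {rmorphism R -> R'})
    (T : finType) (x : T -> R) (S : {set T}) (k : nat) :
  f (esym_on x S k) = esym_on (fun i => f (x i)) S k.
Proof. by rewrite rmorph_sum; apply: eq_bigr => h _; rewrite rmorph_prod. Qed.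

Lemma mesym_on (R : comNzRingType) (m k : nat) :
  mesym m R k = esym_on (fun i => 'X_i) [set: 'I_m] k.
Proof. by apply: eq_bigl => h; rewrite subsetT. Qed.

(** A polynomial not involving 'X_j is killed by d_j; it is enough to check
    this on the factors of its monomials, by the Leibniz rule. *)
Lemma mderiv_esym_on (R : comNzRingType) (m : nat) (j : 'I_m)
    (S : {set 'I_m}) (k : nat) : j \notin S ->
  mderiv j (esym_on (fun i => 'X_i : {mpoly R[m]}) S k) = 0.
Proof.
move=> jS; rewrite raddf_sum big1 // => h /andP[hS _].
apply: (big_ind (fun p : {mpoly R[m]} => mderiv j p = 0)) => [|p q dp dq|i ih].
- by rewrite -mpolyC1 mderivC.
- by rewrite mderivM dp dq mul0r mulr0 addr0.
rewrite mderivX mnm1E; case: eqP => [ij|_]; last by rewrite scale0r.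
by case/negP: jS; rewrite -ij; apply: (subsetP hS).
Qed.

(** By [esym_onU1], e_(k+1) is affine in 'X_j, and the slope is what remains
    after differentiation. *)
Lemma mderiv_mesymS (R : comNzRingType) (m k : nat) (j : 'I_m) :
  mderiv j (mesym m R k.+1) = esym_on (fun i => 'X_i) (~: [set j]) k.
Proof.
have jS : j \notin ~: [set j] by rewrite !inE eqxx.
have -> : mesym m R k.+1 = esym_on (fun i => 'X_i) (j |: ~: [set j]) k.+1.
  by rewrite setUCr -mesym_on.
rewrite esym_onU1 // mderivD mderivM !mderiv_esym_on //.
rewrite mulr0 addr0 add0r mderivX mnm1E eqxx scale1r -[RHS]mul1r.
by congr (_ * _); rewrite -mpolyX0; congr mpolyX; apply/mnmP => i;
   rewrite !mnmE subnn.
Qed.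

(** * The contribution of one triple *)

(** Expanding each e_k in the two variables outside U turns the left-hand side
    into a combination of e_k(U), e_(k-1)(U), e_(k-2)(U) whose coefficients are
    second divided differences.  The quadratic one has numerator
    x_a (x_b + x_c) = x_a (s - x_a) with s = x_a + x_b + x_c symmetric, so its
    leading coefficient is -1.  The cases k = 0, 1 are those where some of these
    terms are absent. *)
Lemma triple_contribution (F : fieldType) (T : finType) (x : T -> F)
    (U : {set T}) (a b c : T) (k : nat) :
  injective x -> a \notin U -> b \notin U -> c \notin U ->
  a != b -> a != c -> b != c ->
  1 / ((x a - x b) * (x a - x c)) * (x a * esym_on x (b |: (c |: U)) k)
  + 1 / ((x b - x a) * (x b - x c)) * (x b * esym_on x (a |: (c |: U)) k)
  + 1 / ((x c - x a) * (x c - x b)) * (x c * esym_on x (a |: (b |: U)) k)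
  = - (if k is l.+1 then esym_on x U l else 0).
Proof.
move=> x_inj aU bU cU ab ac bc.
have nz i j : i != j -> x i - x j != 0 by rewrite subr_eq0 inj_eq.
have [nab nac nbc] := And3 (nz _ _ ab) (nz _ _ ac) (nz _ _ bc).
have [nba nca ncb] : [/\ x b - x a != 0, x c - x a != 0 & x c - x b != 0].
  by rewrite !nz // eq_sym.
have bcU : b \notin c |: U by rewrite !inE negb_or bc.
have acU : a \notin c |: U by rewrite !inE negb_or ac.
have abU : a \notin b |: U by rewrite !inE negb_or ab.
case: k => [|[|k]]; rewrite !(esym_onU1, esym_on0) //; field;
  by rewrite ?nab ?nac ?nbc ?nba ?nca ?ncb.
Qed.

(** * Counting and summing over triples *)

(** Choosing t+1 elements of S amounts to choosing the least one, a, and then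
    t elements above it.  Induction removes the minimum of S: it contributes
    'C(#|S| - 1, t), it lies above no other element, and Pascal's rule adds up
    the two parts. *)
Lemma sum_binomial_above (m t : nat) (S : {set 'I_m}) :
  (\sum_(a in S) 'C(#|[set b in S | (a < b)%N]|, t))%N = 'C(#|S|, t.+1).
Proof.
elim: {S}_.+1 {-2}S (ltnSn #|S|) => // d IHd S Sd.
have [-> | [s0 s0S]] := set_0Vmem S; first by rewrite big_set0 cards0.
have [a aS a_min] : exists2 a, a \in S & forall b, b \in S -> (a <= b)%N.
  have := @arg_minnP _ s0 (fun i => i \in S) (@nat_of_ord m) s0S.
  by case=> a; exists a.
rewrite (bigD1 a) //= (cardsD1 a S) aS add1n binS addnC; congr (_ + _)%N.
  rewrite -IHd; last by move: Sd; rewrite (cardsD1 a S) aS.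
  apply: eq_big => [b | b /andP[bS ba]]; first by rewrite !inE andbC.
  congr 'C(_, t); apply: eq_card => c; rewrite !inE.
  by case: eqP => [-> | //] /=; rewrite aS /= ltnNge (a_min _ bS).
congr 'C(_, t); apply: eq_card => b; rewrite !inE andbC.
by case bS: (b \in S); rewrite ?andbF ?andbT //;
  rewrite ltn_neqAle a_min // andbT eq_sym.
Qed.

Lemma count_triples (m : nat) (S : {set 'I_m}) :
  (\sum_(a in S) \sum_(b in S | (a < b)%N) \sum_(c in S | (b < c)%N) 1)%N
  = 'C(#|S|, 3).
Proof.
rewrite -sum_binomial_above; apply: eq_bigr => a aS.
rewrite -sum_binomial_above; apply: eq_big => [b | b /andP[bS ab]].
  by rewrite inE.
rewrite sum1_card bin1; apply: eq_card => c; rewrite !inE.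
rewrite unfold_in /=; case: (c \in S) => //=.
by case: ltnP => bc; rewrite ?andbT ?andbF // (ltn_trans ab bc).
Qed.

(** Exchange the sums: each monomial x_h of e_k is counted once for every
    increasing triple in the complement of h, which has m - k elements. *)
Lemma sum_esym_on_triples (R : comNzRingType) (m : nat) (x : 'I_m -> R)
    (k : nat) :
  \sum_(a < m) \sum_(b < m | (a < b)%N) \sum_(c < m | (b < c)%N)
    esym_on x (~: [set a; b; c]) k
  = ('C(m - k, 3))%:R * esym_on x [set: 'I_m] k.
Proof.
(* With the condition inside the summand, the range of h no longer depends
   on the triple and the sums can be exchanged. *)
pose E (h : {set 'I_m}) (a b c : 'I_m) : R :=
  if [&& a \in ~: h, b \in ~: h & c \in ~: h] then \prod_(i in h) x i else 0.
have expand a b c : esym_on x (~: [set a; b; c]) k =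
    \sum_(h : {set 'I_m} | #|h| == k) E h a b c.
  rewrite /esym_on /E -big_mkcondr; apply: eq_bigl => h.
  by rewrite andbC -disjoints_subset disjoint_sym !disjoints_subset
     !subUset !sub1set -andbA.
rewrite (eq_bigr (fun a : 'I_m => \sum_(h : {set 'I_m} | #|h| == k)
  \sum_(b < m | (a < b)%N) \sum_(c < m | (b < c)%N) E h a b c)); last first.
  move=> a _; rewrite exchange_big; apply: eq_bigr => b _.
  by rewrite exchange_big; apply: eq_bigr => c _.
rewrite exchange_big /= /esym_on big_distrr /=.
apply: eq_big => [h | h /eqP hk]; first by rewrite subsetT.
have -> : (m - k)%N = #|~: h| by rewrite cardsCs setCK card_ord hk.
rewrite -count_triples natr_sum big_distrl [RHS]big_mkcond /=.
apply: eq_bigr => a _; rewrite /E; case: ifP => aS /=; last first.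
  by rewrite big1 // => b _; rewrite big1.
rewrite natr_sum big_distrl [RHS]big_mkcondl /=.
apply: eq_bigr => b _; case: ifP => bS /=; last by rewrite big1.
rewrite natr_sum big_distrl [RHS]big_mkcondl /=.
by apply: eq_bigr => c _; case: ifP => _; rewrite ?mul1r.
Qed.

(** An index j and a pair i < r of other indices form a three-element set with
    j marked; the three terms on the right correspond to j being the least, the
    middle and the greatest element. *)
Lemma sum_by_triples (V : zmodType) (m : nat) (g : 'I_m -> 'I_m -> 'I_m -> V) :
  \sum_(j < m) \sum_(i < m | i != j)
     \sum_(r < m | (i < r)%N && (r != j)) g j i r
  = \sum_(a < m) \sum_(b < m | (a < b)%N) \sum_(c < m | (b < c)%N)
      (g a b c + g b a c + g c a b).
Proof.
pose lt3 (a b c : 'I_m) := (a < b < c)%N.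
have mk3 (f : 'I_m -> 'I_m -> 'I_m -> V) :
    \sum_(a < m) \sum_(b < m | (a < b)%N) \sum_(c < m | (b < c)%N) f a b c
    = \sum_(a < m) \sum_b \sum_c (if lt3 a b c then f a b c else 0).
  apply: eq_bigr => a _; rewrite big_mkcond; apply: eq_bigr => b _.
  rewrite /lt3; case: ifP => ab /=; last by rewrite big1.
  by rewrite big_mkcond.
rewrite mk3.
have -> : \sum_(a < m) \sum_b \sum_c
      (if lt3 a b c then g a b c + g b a c + g c a b else 0)
    = \sum_(a < m) \sum_b \sum_c (if lt3 a b c then g a b c else 0)
      + \sum_(a < m) \sum_b \sum_c (if lt3 b a c then g a b c else 0)
      + \sum_(a < m) \sum_b \sum_c (if lt3 b c a then g a b c else 0).
  rewrite [X in _ = _ + X + _]exchange_big /=.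
  have -> : \sum_(a < m) \sum_b \sum_c (if lt3 b c a then g a b c else 0)
      = \sum_(a < m) \sum_b \sum_c (if lt3 a b c then g c a b else 0).
    rewrite exchange_big; apply: eq_bigr => a _.
    by rewrite exchange_big.
  rewrite -!big_split; apply: eq_bigr => a _.
  rewrite -!big_split; apply: eq_bigr => b _.
  rewrite -!big_split; apply: eq_bigr => c _.
  by rewrite /=; case: ifP => _; rewrite ?addr0.
(* Both sides are now sums over the same (j, i, r); given i < r and
   j distinct from both, exactly one of j < i, i < j < r and r < j holds. *)
rewrite -!big_split; apply: eq_bigr => j _.
rewrite -!big_split big_mkcond; apply: eq_bigr => i _.
rewrite -!big_split /=.
have -> : (if i != j then \sum_(r < m | (i < r)%N && (r != j)) g j i r else 0)
    = \sum_(r < m) (if [&& i != j, (i < r)%N & r != j] then g j i r else 0).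
  by case: ifP => _ /=; [rewrite big_mkcond | rewrite big1].
apply: eq_bigr => r _; rewrite /lt3 -!(inj_eq val_inj) /=.
by case: (ltngtP i j); case: (ltngtP i r); case: (ltngtP j r);
  rewrite ?addr0 ?add0r //=; lia.
Qed.

(** * The action of Q2 *)

Lemma xvar_inj (K : fieldType) (m : nat) : injective (@xvar K m).
Proof.
move=> i j /eqP; rewrite /xvar tofrac_eq => /eqP/(congr1 (mcoeff U_(i)%MM)).
rewrite !mcoeffX eqxx eq_mnm1; case: eqP => // _ /eqP.
by rewrite oner_eq0.
Qed.

(** The value 0 for k = 0 plays the part of e_(-1). *)
Lemma Q2_mesymS (K : fieldType) (m k : nat) :
  Q2 (mesym m K k.+1) =
  - (if k is l.+1 then ('C(m - l, 3))%:R * tofrac (mesym m K l) else 0).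
Proof.
set x := @xvar K m.
have fracE (S : {set 'I_m}) l :
    tofrac (esym_on (fun i => 'X_i : {mpoly K[m]}) S l) = esym_on x S l.
  exact: rmorph_esym_on.
rewrite /Q2 sum_by_triples.
transitivity (\sum_(a < m) \sum_(b < m | (a < b)%N) \sum_(c < m | (b < c)%N)
    - (if k is l.+1 then esym_on x (~: [set a; b; c]) l else 0)).
  apply: eq_bigr => a _; apply: eq_bigr => b ab; apply: eq_bigr => c bc.
  rewrite !mderiv_mesymS !fracE.
  have ac := ltn_trans ab bc.
  have [nab nac nbc] : [/\ a != b, a != c & b != c].
    by rewrite -!(inj_eq val_inj) /= !ltn_eqF.
  rewrite -(@triple_contribution _ _ x _ a b c) ?(inE, eqxx, orbT) //;
    last exact: xvar_inj.
  congr (_ * (_ * esym_on x _ k) + _ * (_ * esym_on x _ k)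
         + _ * (_ * esym_on x _ k)); apply/setP => i; rewrite !inE.
  - case: (eqVneq i a) => [->|]; rewrite ?(negbTE nab) ?(negbTE nac) //=.
    by case: (eqVneq i b) => //; case: (eqVneq i c).
  - case: (eqVneq i b) => [->|];
      rewrite ?(eq_sym b a) ?(negbTE nab) ?(negbTE nbc) //=.
    by case: (eqVneq i a) => //; case: (eqVneq i c).
  case: (eqVneq i c) => [->|];
    rewrite ?(eq_sym c) ?(negbTE nac) ?(negbTE nbc) //=.
  by case: (eqVneq i a) => //; case: (eqVneq i b).
under eq_bigr => a _ do (under eq_bigr => b _ do rewrite sumrN; rewrite sumrN).
rewrite sumrN; congr (- _); case: k => [|l].
  by rewrite big1 // => a _; rewrite big1 // => b _; rewrite big1.
by rewrite sum_esym_on_triples mesym_on fracE.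
Qed.

Theorem lemma5p4 (K : fieldType) (n : nat) (hn : (2 <= n)%N)
    (k : int) (hk : 1 <= k) :
  Q2 (esymz K n.-1 k) =
  - ((binz (n%:Z - k + 1) 3)%:R * tofrac (esymz K n.-1 (k - 2))).
Proof.
case: k hk => [[|[|l]]|] // _.
  by rewrite /esymz /= Q2_mesymS tofrac0 mulr0.
have -> : l.+2%:Z - 2 = l%:Z by lia.
rewrite /esymz Q2_mesymS; congr (- _).
(* Beyond the number of variables, e_l = 0, and the truncated subtraction
   n.-1 - l no longer matches the integer argument of [binz]. *)
have [le_l | gt_l] := leqP l n.-1; last first.
  by rewrite mesym_on esym_on_gt ?cardsT ?card_ord // tofrac0 !mulr0.
by have -> : n%:Z - l.+2%:Z + 1 = (n.-1 - l)%N%:Z by lia.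
Qed.
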